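(* For every $n\ge 4$, the graph $\mathcal{S}_n^0$ is connected.
   Context: A triangulated $2$-sphere is a finite simplicial complex whose geometric realization is homeomorphic to the $2$-sphere. Edge flip $ab\mapsto cd$: if $abc,abd$ are triangles and $cd$ is not an edge, replace $abc,abd$ by $acd,bcd$. A stacked $3$-ball is a simplicial complex obtained from a single tetrahedron by repeatedly gluing a new tetrahedron along exactly one boundary triangle, introducing one new vertex each time. A stacked $2$-sphere is a triangulated $2$-sphere isomorphic to the boundary of a stacked $3$-ball. For a stacked $2$-sphere $S$, $\overline{S}$ denotes the simplicial complex whose faces are all cliques of the edge graph of $S$; it is known that $\overline{S}$ is a stacked $3$-ball with boundary $S$, unique up to isomorphism. The dual graph $\Lambda(C)$ of a complex made of tetrahedra has the tetrahedra as nodes, adjacent iff they share a triangle. $\mathcal{S}_n^0$ is the graph whose nodes are the isomorphism classes of $n$-vertex stacked $2$-spheres $S$ such that $\Lambda(\overline{S})$ has no node of degree four, two nodes being adjacent iff a representative of one can be transformed into a representative of the other by a single edge flip. *)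

(* Defs.v *)
(* Simplicial complexes are represented by their facets:
   a finite set of finite vertex sets over a finite vertex type. *)
From Stdlib Require Export Relations.
From HB Require Import structures.
From mathcomp Require Import all_boot.
Set Implicit Arguments. Unset Strict Implicit. Unset Printing Implicit Defensive.

Section Complexes.
Variable T : finType.

Definition verts (K : {set {set T}}) : {set T} := \bigcup_(s in K) s.

Definition boundary (B : {set {set T}}) : {set {set T}} :=
  [set f : {set T} | (#|f| == 3) && (#|[set t in B | f \subset t]| == 1)].

Inductive stacked_ball : {set {set T}} -> Prop :=
| sb_tet (t : {set T}) : #|t| = 4 -> stacked_ball [set t]
| sb_glue (B : {set {set T}}) (f : {set T}) (v : T) :
    stacked_ball B -> f \in boundary B -> v \notin verts B ->
    stacked_ball ((v |: f) |: B).

Definition edgeb (S : {set {set T}}) (x y : T) : bool :=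
  (x != y) && [exists t in S, (x \in t) && (y \in t)].

Definition clique (S : {set {set T}}) (c : {set T}) : bool :=
  [forall x in c, forall y in c, (x != y) ==> edgeb S x y].

Definition bar_tets (S : {set {set T}}) : {set {set T}} :=
  [set c : {set T} | clique S c && (#|c| == 4)].

Definition dual_deg (C : {set {set T}}) (t : {set T}) : nat :=
  #|[set t' in C | (t' != t) && (#|t :&: t'| == 3)]|.

Definition no_deg4 (S : {set {set T}}) : Prop :=
  forall t, t \in bar_tets S -> dual_deg (bar_tets S) t <> 4.

Definition eflip (S S' : {set {set T}}) : Prop :=
  exists a b c d : T,
    #|[set a; b; c]| = 3 /\ #|[set a; b; d]| = 3 /\ c != d /\
    [set a; b; c] \in S /\ [set a; b; d] \in S /\ ~~ edgeb S c d /\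
    S' = [set [set a; c; d]; [set b; c; d]] :|:
         (S :\: [set [set a; b; c]; [set a; b; d]]).

End Complexes.

Definition cx_iso (T1 T2 : finType) (K : {set {set T1}}) (L : {set {set T2}}) : Prop :=
  exists f : T1 -> T2, {in verts K &, injective f} /\ L = [set (f @: s) | s : {set T1} in K].

Definition stacked_sphere (T : finType) (S : {set {set T}}) : Prop :=
  exists (T' : finType) (B : {set {set T'}}), stacked_ball B /\ cx_iso (boundary B) S.

(* node of S_n^0, representative on vertex set exactly 'I_n *)
Definition S0_node (n : nat) (S : {set {set 'I_n}}) : Prop :=
  verts S = [set: 'I_n] /\ stacked_sphere S /\ no_deg4 S.

(* adjacency of the isomorphism classes of S1 and S2: some representative of
   one is transformed into some representative of the other by one flip *)
Definition S0_adj (n : nat) (S1 S2 : {set {set 'I_n}}) : Prop :=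
  exists (T : finType) (X Y : {set {set T}}),
    cx_iso S1 X /\ cx_iso S2 Y /\ (eflip X Y \/ eflip Y X).

Definition S0_connected (n : nat) : Prop :=
  (exists S : {set {set 'I_n}}, S0_node S) /\
  forall S1 S2 : {set {set 'I_n}}, S0_node S1 -> S0_node S2 ->
    clos_refl_trans _ (fun X Y => S0_node X /\ S0_node Y /\ S0_adj X Y) S1 S2.

(* Main.v *)
Require Import Defs.
From mathcomp Require Import all_boot.
From mathcomp Require Import zify.
Set Implicit Arguments. Unset Strict Implicit. Unset Printing Implicit Defensive.

(** Root a stacked ball at a tetrahedron [pabc] that is a leaf of the dual tree,
    attached along [abc].  The rest is a rooted tree in which every node has three
    child slots, and "no node of degree four" says that each node has an empty slot.
    A flip of an edge shared by free faces of adjacent tetrahedra [t1], [t2] is a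
    tree rotation: if slot [i] is empty in a node and in its child in slot [j], the
    two nodes rotate as in a binary tree with slots [j] and [k].  Rotating, together
    with rebuilding smaller subtrees by induction, turns every tree into the comb
    whose children all sit in the third slot, and combs of equal size are
    isomorphic. *)

(** A rotation needs one slot that is empty in both a node and its child, while [good] gives each of
    them some empty slot, perhaps not the same one. Combs remove this mismatch: their nodes have two
    empty slots, so a child already brought to a comb shares an empty slot with its parent unless
    the comb runs along the very slot that is empty in the parent. Combs along slot three serve
    parents with slot one or two empty; a parent with slot three empty calls for combs along slot
    two. The induction therefore carries both kinds.

    The degree condition is stated through cliques of the sphere, while the argument handles balls;
    the two agree because a stacked ball has no interior edge. The root [pabc] is never constrained,
    having three free faces, and a rotation keeps the common slot empty in both nodes, so a path of
    rotations never leaves the graph.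

    Base triangles are kept as ordered triples. This makes slots meaningful and lets a rotation
    carry the hanging subtrees over unchanged. *)

Section Balls.
Variable T : finType.
Implicit Types (B K : {set {set T}}) (f g s t : {set T}) (v x y z : T).

(** * Boundary of a stacked ball under gluing *)

Definition star v f : {set {set T}} :=
  [set g : {set T} | [&& v \in g, #|g| == 3 & g \subset v |: f]].

Lemma sub_verts B t x : t \in B -> x \in t -> x \in verts B.
Proof. by move=> tB xt; apply/bigcupP; exists t. Qed.

Lemma boundaryP B f : f \in boundary B ->
  #|f| = 3 /\ exists2 t, t \in B & f \subset t.
Proof.
rewrite inE => /andP[/eqP f3 /cards1P[t ft]]; split=> //.
by have := set11 t; rewrite -ft inE => /andP[? ?]; exists t.
Qed.

Lemma boundary_sub_verts B f : f \in boundary B -> f \subset verts B.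
Proof.
move=> /boundaryP[_ [t tB ft]]; apply/subsetP=> x xf.
exact: sub_verts tB (subsetP ft x xf).
Qed.

Lemma card_cofaces_glue B f v g : v \notin verts B ->
  #|[set t in (v |: f) |: B | g \subset t]|
  = (g \subset v |: f) + #|[set t in B | g \subset t]|.
Proof.
move=> vB; have nB : v |: f \notin B.
  by apply: contra vB => fB; apply: sub_verts fB (setU11 _ _).
case: (boolP (g \subset v |: f)) => gf /=.
- rewrite -(_ : (v |: f) |: [set t in B | g \subset t] = [set t in _ | _]).
    by rewrite cardsU1 inE (negPf nB).
  by apply/setP=> t; rewrite !inE; case: eqP => [->|].
- rewrite add0n; apply: eq_card=> t; rewrite !inE.
  by case: eqP => [->|//]; rewrite (negPf gf) !andbF.
Qed.

Lemma cofaces_fresh B v g : v \notin verts B -> v \in g ->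
  #|[set t in B | g \subset t]| = 0.
Proof.
move=> vB vg; apply: eq_card0 => t; rewrite !inE.
apply: contraNF vB => /andP[tB /subsetP gt]; exact: sub_verts tB (gt _ vg).
Qed.

Lemma sub_glue v f g : v \notin g -> #|g| = 3 -> #|f| = 3 ->
  (g \subset v |: f) = (g == f).
Proof.
move=> vg g3 f3; rewrite eqEcard g3 f3 leqnn andbT.
apply/idP/idP => [|/subset_trans-> //]; last exact: subsetUr.
move=> /subsetP gvf; apply/subsetP=> x xg; have := gvf x xg.
by rewrite !inE; case: eqP vg xg => // -> /negPf->.
Qed.

(** Triangles through the fresh [v] have the new tetrahedron as their only coface. Among the others
    only [f] gains a coface; it then has two and leaves the boundary. *)
Lemma boundary_glue B f v : f \in boundary B -> v \notin verts B ->
  boundary ((v |: f) |: B) = star v f :|: boundary B :\ f.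
Proof.
move=> fB vB; apply/setP=> g; rewrite !inE card_cofaces_glue //.
have [f3 _] := boundaryP fB; move: fB; rewrite inE => /andP[_ /eqP f1].
case: (boolP (v \in g)) => vg /=.
  rewrite (cofaces_fresh vB vg) !andbF orbF addn0.
  by case: (g \subset _); rewrite ?andbT ?andbF.
case: eqP => [g3|]; last by rewrite /= andbF.
by rewrite sub_glue //; case: (eqVneq g f) => [->|_] /=; rewrite ?f1 ?g3.
Qed.

Lemma starP v f g : v \notin f -> #|f| = 3 -> g \in star v f ->
  exists2 x, x \in f & g = v |: f :\ x.
Proof.
move=> vf f3; rewrite inE => /and3P[vg /eqP g3 /subsetP gf].
(* Besides [v], [g] has only two vertices, so it omits one of the three vertices of [f]. *)
have : 0 < #|f :\: g|.
  have sub : f :&: g \subset g :\ v.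
    apply/subsetP=> x; rewrite !inE => /andP[xf ->]; rewrite andbT.
    by apply: contraNneq vf => <-.
  have := subset_leq_card sub; have := cardsD1 v g.
  by have := cardsID g f; rewrite vg; lia.
case/card_gt0P=> x; rewrite inE => /andP[xg xf]; exists x => //.
apply/eqP; rewrite eqEcard; apply/andP; split.
  apply/subsetP=> y yg; have := gf y yg; rewrite !inE.
  by case: eqP => //= _ ->; rewrite andbT; apply: contraNneq xg => <-.
have := cardsD1 x f; rewrite cardsU1 !inE (negPf vf) andbF xf; lia.
Qed.

Lemma mem_star v f x : v \notin f -> #|f| = 3 -> x \in f ->
  v |: f :\ x \in star v f.
Proof.
move=> vf f3 xf; rewrite inE setU11 /=; apply/andP; split.
  have := cardsD1 x f; rewrite cardsU1 !inE (negPf vf) andbF xf; lia.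
apply/subsetP=> y; rewrite !inE; case: eqP => //= _ /andP[_ ->].
by [].
Qed.

Lemma ball_card B t : stacked_ball B -> t \in B -> #|t| = 4.
Proof.
elim=> {B} [t' t4|B f v _ IH fB vB]; first by rewrite inE => /eqP->.
rewrite !inE => /orP[/eqP->|/IH //]; rewrite cardsU1.
have [-> _] := boundaryP fB; rewrite (_ : v \notin f) //.
by apply: contra vB; apply: (subsetP (boundary_sub_verts fB)).
Qed.

(** * Recovering a ball and its dual degrees from its boundary *)

Lemma ball_cofaces B f : stacked_ball B -> #|f| = 3 ->
  #|[set t in B | f \subset t]| <= 2.
Proof.
move=> sB f3; elim: sB => {B} [t' t4|B g v _ IH gB vB].
  apply: (@leq_trans #|[set t']|); last by rewrite cards1.
  by apply/subset_leq_card/subsetP=> t; rewrite !inE => /andP[].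
rewrite card_cofaces_glue //.
have [vf|vf] := boolP (v \in f).
  by rewrite (cofaces_fresh vB vf) addn0; case: (_ \subset _).
have [g3 _] := boundaryP gB.
rewrite sub_glue //; case: (eqVneq f g) => [->|_] //=.
by move: gB; rewrite inE => /andP[_ /eqP->].
Qed.

Lemma edgebP (S : {set {set T}}) x y : reflect (x != y /\ exists t, [/\ t \in S, x \in t & y \in t])
  (edgeb S x y).
Proof.
apply: (iffP andP) => [[xy /existsP[t /and3P[]]]|[xy [t [tS xt yt]]]].
  by split=> //; exists t.
by split=> //; apply/existsP; exists t; apply/and3P.
Qed.

(** Gluing hides only the triangle [f], and every edge of the new tetrahedron survives in a triangle
    of [star v f]: omit a vertex [z] of [f] that is not an end of the edge. So no edge ever becomes
    interior. *)
Lemma ball_boundary_edge B x y : stacked_ball B ->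
  edgeb (boundary B) x y = edgeb B x y.
Proof.
move=> sB; apply/edgebP/edgebP => -[xy [t [tB xt yt]]]; split=> //.
  have [_ [s sB' ts]] := boundaryP tB.
  by exists s; split=> //; apply: (subsetP ts).
elim: sB t tB xt yt => {B} [t' t4|B f v _ IH fB vB] t.
  rewrite inE => /eqP-> xt yt; have : 0 < #|t' :\: [set x; y]|.
    have := cardsID [set x; y] t'; rewrite t4.
    have := subset_leq_card (subsetIr t' [set x; y]); rewrite cards2; lia.
  case/card_gt0P=> z; rewrite !inE negb_or => /andP[/andP[zx zy] zt].
  exists (t' :\ z); rewrite !inE xt yt !andbT ![_ == z]eq_sym; split=> //.
  have := cardsD1 z t'; rewrite zt t4 add1n => -[<-]; rewrite eqxx /=.
  apply/cards1P; exists t'; apply/setP=> u; rewrite !inE.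
  by case: eqP => // ->; rewrite subsetDl.
have [f3 _] := boundaryP fB.
have vf : v \notin f by apply: contra vB; apply: (subsetP (boundary_sub_verts fB)).
rewrite boundary_glue // => tB xt yt.
have main z : z \in f -> z != x -> z != y -> x \in v |: f -> y \in v |: f ->
    exists t0, [/\ t0 \in star v f :|: boundary B :\ f, x \in t0 & y \in t0].
  move=> zf zx zy xf yf; exists (v |: f :\ z); rewrite inE mem_star //.
  move: xf yf; rewrite !inE ![_ == z]eq_sym zx zy => xf yf; split=> //; by rewrite ?xf ?yf.
have third : x \in v |: f -> y \in v |: f ->
    exists t0, [/\ t0 \in star v f :|: boundary B :\ f, x \in t0 & y \in t0].
  move=> xf yf; have : 0 < #|f :\: [set x; y]|.
    have := cardsID [set x; y] f; rewrite f3.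
    have := subset_leq_card (subsetIr f [set x; y]); rewrite cards2; lia.
  case/card_gt0P=> z; rewrite !inE negb_or => /andP[/andP[zx zy] zf].
  exact: main zf zx zy xf yf.
move: tB; rewrite !inE => /orP[/eqP tE|tB]; first by apply: third; rewrite -tE.
have [s [sB xs ys]] := IH _ tB xt yt.
have [sE|sf] := eqVneq s f; first by apply: third; rewrite !inE -sE ?xs ?ys orbT.
by exists s; split=> //; rewrite in_setU in_setD1 sf sB orbT.
Qed.

(** All neighbours of the last vertex [v] lie in [f], so a 4-clique through [v] is the last
    tetrahedron. A 4-clique avoiding [v] has all its edges in the older ball, since [f] lies in an
    older tetrahedron; induction applies. *)
Lemma bar_tets_boundary B : stacked_ball B -> bar_tets (boundary B) = B.
Proof.
move=> sB; apply/setP=> c; rewrite inE; apply/andP/idP; last first.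
  move=> cB; split; last by rewrite (ball_card sB cB).
  apply/forall_inP=> x xc; apply/forall_inP=> y yc; apply/implyP=> xy.
  by rewrite ball_boundary_edge //; apply/edgebP; split=> //; exists c.
case=> /forall_inP cl /eqP c4.
have {}cl x y : x \in c -> y \in c -> x != y ->
    exists t, [/\ t \in B, x \in t & y \in t].
  move=> xc yc xy; have /forall_inP/(_ y yc) := cl x xc.
  by rewrite xy ball_boundary_edge // => /edgebP[].
elim: sB cl => {B} [t t4|B f v _ IH fB vB] cl.
  rewrite inE eqEcard c4 t4 andbT; apply/subsetP=> x xc.
  have /card_gt0P[y] : 0 < #|c :\ x| by have := cardsD1 x c; rewrite xc c4; lia.
  rewrite !inE => /andP[yx yc]; rewrite eq_sym in yx.
  by have [s []] := cl x y xc yc yx; rewrite inE => /eqP->.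
have [f3 [s sB fs]] := boundaryP fB; rewrite !inE.
have [vc|vc] := boolP (v \in c).
  apply/orP; left; rewrite eqEcard c4 cardsU1 f3 andbC.
  apply/andP; split; first by case: (_ \notin _).
  apply/subsetP=> x xc; have [->|xv] := eqVneq x v; first exact: setU11.
  have [t []] := cl x v xc vc xv; rewrite !inE => /orP[/eqP-> //|tB _ vt].
  - by rewrite !inE.
  - by case/negP: vB; apply: sub_verts tB vt.
apply/orP; right; apply: IH => x y xc yc xy.
have [t []] := cl x y xc yc xy; rewrite !inE => /orP[/eqP->|tB]; last by exists t.
rewrite !inE; have /negPf-> : x != v by apply: contraNneq vc => <-.
have /negPf-> /= : y != v by apply: contraNneq vc => <-.
by move=> xf yf; exists s; split=> //; apply: (subsetP fs).
Qed.

(** Sending a neighbour [t'] to [t :&: t'] is injective, as a triangle has at most two cofaces. Its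
    image is the set of the triangles of [t] that are not in the boundary, so degree four means that
    none of the four triangles is free. *)
Lemma dual_deg_neq4 B t : stacked_ball B -> t \in B ->
  dual_deg B t <> 4 <-> exists2 f, f \in boundary B & f \subset t.
Proof.
move=> sB tB; have t4 := ball_card sB tB.
pose N := [set t' in B | (t' != t) && (#|t :&: t'| == 3)].
pose F := [set f : {set T} | f \subset t & #|f| == 3].
have F4 : #|F| = 4 by rewrite /F cards_draws t4.
have injN : {in N &, injective (fun t' => t :&: t')}.
  move=> s1 s2; rewrite !inE => /and3P[s1B s1t /eqP s13] /and3P[s2B s2t _] e.
  apply/eqP; apply: contraT => s12.
  have := ball_cofaces sB s13; rewrite leqNgt => /negP[].
  apply: (@leq_trans #|t |: [set s1; s2]|).
    by rewrite cardsU1 cards2 !inE ![t == _]eq_sym (negPf s1t) (negPf s2t) s12.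
  apply/subset_leq_card/subsetP=> s; rewrite !inE.
  case/or3P=> /eqP->; rewrite ?tB ?s1B ?s2B ?subsetIl ?subsetIr //=.
  by rewrite e subsetIr.
have subF : [set t :&: t' | t' in N] \subset F.
  apply/subsetP=> f /imsetP[s]; rewrite !inE => /and3P[_ _ s3] ->.
  by rewrite subsetIl.
rewrite -(_ : #|N| = dual_deg B t) // -(card_in_imset injN) -F4.
have imN f : f \in F -> (f \in [set t :&: t' | t' in N]) = (f \notin boundary B).
  rewrite inE => /andP[ft f3]; rewrite [in RHS]inE f3 /=.
  apply/imsetP/idP => [[s]|].
    rewrite inE => /and3P[sB' st _] fE; rewrite neq_ltn; apply/orP; right.
    rewrite (cardsD1 t) (cardsD1 s) !inE tB sB' ft st fE subsetIr.
    by rewrite !add1n.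
  have -> : #|[set t in B | f \subset t]| = #|[set t0 in B | f \subset t0] :\ t|.+1.
    by rewrite (cardsD1 t) inE tB ft.
  rewrite eqSS -lt0n => /card_gt0P[s]; rewrite !inE => /and3P[st sB' fs].
  have fI : f = t :&: s.
    apply/eqP; rewrite eqEcard subsetI ft fs (eqP f3) /=.
    rewrite -ltnS -t4; apply: proper_card; rewrite properE subsetIl /=.
    apply: contra st => tI; rewrite eq_sym eqEcard t4 (ball_card sB sB') andbT.
    by apply: (subset_trans tI); apply: subsetIr.
  by exists s; rewrite // inE sB' st -fI f3.
split=> [neq|[f fB ft] eq].
- have : [set t :&: t' | t' in N] \proper F.
    rewrite properEcard subF /= ltn_neqAle subset_leq_card // andbT.
    exact/eqP.
  case/properP=> _ [f fF fN]; exists f; last by move: fF; rewrite inE => /andP[].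
  by move: fN; rewrite imN // negbK.
- have fF : f \in F by rewrite inE ft; have [-> _] := boundaryP fB.
  have /eqP E : [set t :&: t' | t' in N] == F by rewrite eqEcard subF eq leqnn.
  by have := imN f fF; rewrite E fF fB.
Qed.

Lemma no_deg4_boundary B : stacked_ball B ->
  no_deg4 (boundary B) <->
  forall t, t \in B -> exists2 f, f \in boundary B & f \subset t.
Proof.
move=> sB; rewrite /no_deg4 bar_tets_boundary //.
by split=> H t tB; apply/(dual_deg_neq4 sB tB)/H.
Qed.
End Balls.

(** * Ternary trees, rotations and combs *)

Inductive tree (T : Type) := Leaf | Node of T & tree T & tree T & tree T.
Arguments Leaf {T}.

Section TreeCombinatorics.
Variable T : Type.
Implicit Types (v w : T) (s : seq T) (t : tree T) (A B C U V W X Y : tree T).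

Fixpoint labels t : seq T :=
  if t is Node v A B C then v :: labels A ++ labels B ++ labels C else [::].

Definition is_leaf t := if t is Leaf then true else false.

(** Of the four triangles of a node's tetrahedron, the base is always shared with the tetrahedron it
    is glued to, so the degree is four exactly when the three slots are filled. *)
Fixpoint good t : bool :=
  if t is Node _ A B C then
    [&& [|| is_leaf A, is_leaf B | is_leaf C], good A, good B & good C]
  else true.

(** [rot1], [rot2], [rot3] are named after the common empty slot. Slot [i] lies over the base with
    its [i]-th vertex replaced by the label; with this convention each hanging subtree sits over the
    same ordered triple on both sides. Opposite rotations come from the symmetric closure. *)
Inductive rotation : tree T -> tree T -> Prop :=
| rot1 v w Y V W : rotation (Node v Leaf Y (Node w Leaf V W))
                            (Node w Leaf (Node v Leaf Y V) W)
| rot2 v w X U W : rotation (Node v X Leaf (Node w U Leaf W))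
                            (Node w (Node v X Leaf U) Leaf W)
| rot3 v w X U V : rotation (Node v X (Node w U V Leaf) Leaf)
                            (Node w (Node v X U Leaf) V Leaf)
| rot_in1 v A A' B C : rotation A A' -> rotation (Node v A B C) (Node v A' B C)
| rot_in2 v A B B' C : rotation B B' -> rotation (Node v A B C) (Node v A B' C)
| rot_in3 v A B C C' : rotation C C' -> rotation (Node v A B C) (Node v A B C').

Notation rot_equiv := (clos_refl_sym_trans _ rotation).

Lemma rotation_leaf t t' : rotation t t' -> is_leaf t = is_leaf t'.
Proof. by case. Qed.

Lemma rotation_good t t' : rotation t t' -> good t = good t'.
Proof.
elim=> {t t'} //=.
- by move=> v w Y V W; rewrite !andbA.
- by move=> v w X U W; rewrite ?orbT ?andbT /= !andbA.
- by move=> v w X U V; rewrite ?orbT ?andbT /= !andbA.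
- by move=> v A A' B C /rotation_leaf-> ->.
- by move=> v A B B' C /rotation_leaf-> ->.
- by move=> v A B C C' /rotation_leaf-> ->.
Qed.

Lemma rotation_count (P : pred T) t t' :
  rotation t t' -> count P (labels t) = count P (labels t').
Proof. elim=> {t t'} /= *; rewrite ?count_cat /= ?count_cat /=; lia. Qed.

Lemma rotation_size t t' : rotation t t' -> size (labels t) = size (labels t').
Proof. by move=> r; rewrite -!count_predT; apply: rotation_count. Qed.

Lemma rot_equiv_size t t' : rot_equiv t t' -> size (labels t) = size (labels t').
Proof. by elim=> {t t'} // [t t' /rotation_size|t1 t2 t3 _ -> _ ->]. Qed.

Lemma rot_equiv_good t t' : rot_equiv t t' -> good t = good t'.
Proof. by elim=> {t t'} // [t t' /rotation_good|t1 t2 t3 _ -> _ ->]. Qed.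

Lemma rot_equiv_ctx (F : tree T -> tree T) t t' :
    (forall u u', rotation u u' -> rotation (F u) (F u')) ->
  rot_equiv t t' -> rot_equiv (F t) (F t').
Proof.
move=> HF; elim=> {t t'}.
- by move=> t t' /HF; apply: rst_step.
- by move=> t; apply: rst_refl.
- by move=> t t' _; apply: rst_sym.
- by move=> t1 t2 t3 _ r12 _; apply: rst_trans.
Qed.

Definition comb (nd : T -> tree T -> tree T -> tree T) s : tree T :=
  foldr (fun v => nd v Leaf) Leaf s.

(* Within nodes having one prescribed empty slot, rotations are the usual ones
   of binary trees. *)
Definition binary (nd : T -> tree T -> tree T -> tree T) : Prop :=
  [/\ forall v w Y V W, rot_equiv (nd v Y (nd w V W)) (nd w (nd v Y V) W),
      forall v W Y Y', rotation Y Y' -> rotation (nd v Y W) (nd v Y' W),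
      forall v Y W W', rotation W W' -> rotation (nd v Y W) (nd v Y W') &
      forall v Y W, size (labels (nd v Y W)) = (size (labels Y) + size (labels W)).+1
        /\ good (nd v Y W) = good Y && good W].

Lemma binary_flip nd : binary nd -> binary (fun v Y W => nd v W Y).
Proof.
case=> rot c1 c2 sz; split=> //.
- by move=> v w Y V W; apply: rst_sym.
- by move=> v Y W; have [-> ->] := sz v W Y; rewrite addnC andbC.
Qed.

Lemma size_labels0 t : size (labels t) = 0 -> t = Leaf.
Proof. by case: t. Qed.

(** Once [Y] is a nonempty comb, its root [u] has an empty left child. Rotating [u] above [v] leaves
    that empty child on the left of the new root, and the right child, smaller by one node, is
    handled by [IH]. *)
Lemma binary_comb nd n : binary nd ->
    (forall t, size (labels t) <= n -> good t ->
       exists s, rot_equiv t (comb nd s)) ->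
  forall v Y W, size (labels (nd v Y W)) <= n.+1 -> good (nd v Y W) ->
    exists s, rot_equiv (nd v Y W) (comb nd s).
Proof.
case=> rot c1 c2 sz IH v Y W; have [-> ->] := sz v Y W.
rewrite ltnS => le_n /andP[gY gW].
have [s rY] := IH Y (leq_trans (leq_addr _ _) le_n) gY.
have szY := rot_equiv_size rY.
have gYs := rot_equiv_good rY; rewrite gY in gYs.
case: s => [|u s] in rY szY gYs.
  rewrite (size_labels0 szY).
  have [s rW] := IH W (leq_trans (leq_addl _ _) le_n) gW.
  exists (v :: s); exact: (@rot_equiv_ctx (nd v Leaf) _ _ (c2 v Leaf) rW).
rewrite /= in szY gYs; have [szu gu] := sz u Leaf (comb nd s).
rewrite -/(comb nd s) szu gu /= in szY gYs.
have [szv gv] := sz v (comb nd s) W.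
have [||s' r'] := IH (nd v (comb nd s) W); first by rewrite szv; lia.
  by rewrite gv -gYs.
exists (u :: s'); apply: rst_trans (_ : rot_equiv _ (nd v (nd u Leaf (comb nd s)) W)) _.
  exact: (@rot_equiv_ctx (fun Z => nd v Z W) _ _ (c1 v W) rY).
apply: rst_trans (_ : rot_equiv _ (nd u Leaf (nd v (comb nd s) W))) _.
  exact/rst_sym/rot.
exact: (@rot_equiv_ctx (nd u Leaf) _ _ (c2 u Leaf) r').
Qed.

Definition node1 v Y W := Node v Leaf Y W.
Definition node2 v Y W := Node v Y Leaf W.
Definition node3 v Y W := Node v Y W Leaf.

Lemma binary_node1 : binary node1.
Proof.
split=> *; [exact/rst_step/rot1|exact: rot_in2|exact: rot_in3|].
by rewrite /= !size_cat.
Qed.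

Lemma binary_node2 : binary node2.
Proof.
split=> *; [exact/rst_step/rot2|exact: rot_in1|exact: rot_in3|].
by rewrite /= !size_cat orbT.
Qed.

Lemma binary_node3 : binary node3.
Proof.
split=> *; [exact/rst_step/rot3|exact: rot_in1|exact: rot_in2|].
by rewrite /= !size_cat addn0 !orbT andbT.
Qed.

(** The first comb runs along the third slot, the second along the second slot. The latter feeds the
    inductive step at a node whose third slot is empty. *)
Lemma rot_equiv_combs n t : size (labels t) <= n -> good t ->
  (exists s, rot_equiv t (comb node1 s)) /\
  (exists s, rot_equiv t (comb (fun v Y W => node1 v W Y) s)).
Proof.
elim: n t => [|n IH] t.
  by rewrite leqn0 => /eqP/size_labels0-> _; split; exists [::]; apply: rst_refl.
case: t => [|v A B C]; first by split; exists [::]; apply: rst_refl.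
have IH3 t tn gt := proj1 (IH t tn gt); have IH2 t tn gt := proj2 (IH t tn gt).
move=> szn gN.
(* Since the root of a comb has two empty slots, a comb for [nd1] is also an [nd2] node with its
   only child on the left, and [binary_comb] for [nd2] straightens it along the other slot. *)
have chain nd1 nd2 : binary nd2 -> (forall x Z, nd1 x Leaf Z = nd2 x Z Leaf) ->
    (forall t, size (labels t) <= n -> good t ->
       exists s, rot_equiv t (comb nd2 s)) ->
    (exists s, rot_equiv (Node v A B C) (comb nd1 s)) ->
    exists s, rot_equiv (Node v A B C) (comb nd2 s).
  move=> bnd2 nd12 IHnd2 [[|x s] ru]; first by exists [::].
  rewrite /= nd12 -/(comb nd1 s) in ru.
  have := binary_comb bnd2 IHnd2 (v := x) (Y := comb nd1 s) (W := Leaf).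
  rewrite -(rot_equiv_size ru) -(rot_equiv_good ru) => /(_ szn gN)[s' rs'].
  by exists s'; apply: rst_trans ru rs'.
have to2 := chain node1 _ (binary_flip binary_node1) (fun _ _ => erefl) IH2.
have to3 := chain (fun v Y W => node1 v W Y) _ binary_node1 (fun _ _ => erefl) IH3.
suff E : exists s, rot_equiv (Node v A B C) (comb node1 s) by split=> //; apply: to2.
move: (gN) => /andP[/or3P[] + _].
- case: A szn gN {chain to2 to3} => // szn gN _.
  exact: (binary_comb binary_node1 IH3 szn gN).
(* Combs for [node2] and for [node1] both run along the third slot and are convertible, so [IH3]
   applies here. *)
- case: B szn gN {chain to2 to3} => // szn gN _.
  exact: (binary_comb binary_node2 IH3 szn gN).
(* Combs for [node3] run along the second slot: hence [IH2], and then [to3] to change the slot. *)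
- case: C szn gN {chain to2} to3 => // szn gN to3 _; apply: to3.
  exact: (binary_comb binary_node3 IH2 szn gN).
Qed.
End TreeCombinatorics.

Lemma mem_count (T : eqType) (s : seq T) z : (z \in s) = (0 < count_mem z s).
Proof. by rewrite -has_count has_pred1. Qed.

Lemma uniq_count (T : eqType) (s : seq T) :
  uniq s <-> forall z, count_mem z s <= 1.
Proof.
split=> [u z|H]; first by rewrite count_uniq_mem //; case: (_ \in _).
apply: count_mem_uniq => z; rewrite mem_count; have := H z.
by case: (count_mem z s) => [|[]].
Qed.

(* Memberships and distinctness of labels are turned into inequalities between
   the numbers of occurrences of one given label. *)
Ltac count_at U z :=
  have := proj1 (uniq_count _) U z;
  rewrite ?mem_count ?inE /= ?mem_cat ?count_cat /= ?count_cat /= ?eqxx /=.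

Ltac count_lia U z := count_at U z; clear; lia.

Ltac set3 := by apply/setP=> ?; rewrite !inE; do !case: (_ == _).

Ltac set_bool :=
  let g := fresh in apply/setP=> g; rewrite !inE;
  repeat match goal with
  | |- context [g \in ?F] => case: (g \in F)
  | |- context [g == ?F] => case: (g == F)
  end; done.

(** * Triangles and tetrahedra of a tree; rotations as flips *)

Section Geometry.
Variable T : finType.
Implicit Types (a b c p u v w x y z : T) (f g : {set T}) (t A B C : tree T).
Implicit Types (K S X : {set {set T}}).

(** These are the triangles that replace [abc] in a boundary when the tree is glued there; an empty
    tree leaves [abc] in place. *)
Fixpoint faces a b c t : {set {set T}} :=
  if t is Node v A B C then faces v b c A :|: faces a v c B :|: faces a b v C
  else [set [set a; b; c]].

Fixpoint tets a b c t : {set {set T}} :=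
  if t is Node v A B C then
    (v |: [set a; b; c]) |: (tets v b c A :|: tets a v c B :|: tets a b v C)
  else set0.

Lemma uniq_node a b c v A B C :
  uniq [:: a, b, c & labels (Node v A B C)] ->
  [/\ uniq [:: v, b, c & labels A], uniq [:: a, v, c & labels B]
    & uniq [:: a, b, v & labels C]].
Proof. by move=> U; split; apply/uniq_count => z; count_lia U z. Qed.

Lemma set3_card a b c : (#|[set a; b; c]| == 3) = uniq [:: a; b; c].
Proof.
rewrite -(_ : [set x in [:: a; b; c]] = [set a; b; c]); last first.
  by apply/setP=> x; rewrite !inE orbA.
rewrite cardsE; apply/eqP/idP => [E|/card_uniqP //].
by apply/card_uniqP; rewrite E.
Qed.

Lemma faces_sub a b c t g z : g \in faces a b c t -> z \in g ->
  z \in [:: a, b, c & labels t].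
Proof.
elim: t a b c => [|v A IA B IB C IC] a b c /=.
  by rewrite inE => /eqP->; rewrite !inE orbA.
rewrite !in_setU => /orP[/orP[]|] /[dup] gF.
- move/IA=> /[apply]; rewrite !inE !mem_cat; lia.
- move/IB=> /[apply]; rewrite !inE !mem_cat; lia.
- move/IC=> /[apply]; rewrite !inE !mem_cat; lia.
Qed.

Lemma faces_card a b c t g : uniq [:: a, b, c & labels t] ->
  g \in faces a b c t -> #|g| = 3.
Proof.
elim: t a b c => [|v A IA B IB C IC] a b c U /=.
  by rewrite inE => /eqP->; apply/eqP; rewrite set3_card.
have [UA UB UC] := uniq_node U; rewrite !in_setU => /orP[/orP[]|].
- exact: IA. - exact: IB. - exact: IC.
Qed.

Lemma base_in_faces a b c t z : z \in [:: a; b; c] ->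
  exists2 g, g \in faces a b c t & z \in g.
Proof.
elim: t a b c => [|v A IA B IB C IC] a b c zabc /=.
  by exists [set a; b; c]; rewrite !inE //; move: zabc; rewrite !inE orbA.
move: zabc; rewrite !inE => /or3P[] zE.
- have [|g gF zg] := IB a v c; first by rewrite !inE zE.
  by exists g; rewrite // !inE gF ?orbT.
- have [|g gF zg] := IA v b c; first by rewrite !inE zE !orbT.
  by exists g; rewrite // !inE gF ?orbT.
- have [|g gF zg] := IA v b c; first by rewrite !inE zE !orbT.
  by exists g; rewrite // !inE gF ?orbT.
Qed.

Lemma label_in_faces a b c t z : z \in labels t ->
  exists2 g, g \in faces a b c t & z \in g.
Proof.
elim: t a b c => [|v A IA B IB C IC] a b c //=.
rewrite inE !mem_cat => /or4P[/eqP->|/IA|/IB|/IC].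
- have [|g gF zg] := @base_in_faces v b c A v; first by rewrite !inE eqxx.
  by exists g; rewrite // !inE gF.
- by move=> /(_ v b c)[g gF zg]; exists g; rewrite // !inE gF ?orbT.
- by move=> /(_ a v c)[g gF zg]; exists g; rewrite // !inE gF ?orbT.
- by move=> /(_ a b v)[g gF zg]; exists g; rewrite // !inE gF ?orbT.
Qed.

Lemma faces_new a b c t g : uniq [:: a, b, c & labels t] ->
  g \in faces a b c t -> t = Leaf \/ exists2 z, z \in labels t & z \in g.
Proof.
elim: t a b c => [|v A IA B IB C IC] a b c U; first by left.
have [UA UB UC] := uniq_node U.
rewrite /= !in_setU => /orP[/orP[]|] gF; right.
- have [E|[z zA zg]] := IA _ _ _ UA gF.
    by exists v; rewrite ?mem_head //; move: gF; rewrite E inE => /eqP->; rewrite !inE eqxx.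
  by exists z; rewrite // inE !mem_cat zA !orbT.
- have [E|[z zA zg]] := IB _ _ _ UB gF.
    by exists v; rewrite ?mem_head //; move: gF; rewrite E inE => /eqP->; rewrite !inE eqxx orbT.
  by exists z; rewrite // inE !mem_cat zA !orbT.
- have [E|[z zA zg]] := IC _ _ _ UC gF.
    by exists v; rewrite ?mem_head //; move: gF; rewrite E inE => /eqP->; rewrite !inE eqxx orbT.
  by exists z; rewrite // inE !mem_cat zA !orbT.
Qed.

Lemma faces_notin a b c t g z : g \in faces a b c t ->
  z \notin [:: a, b, c & labels t] -> z \notin g.
Proof. by move=> gF; apply: contra; apply: faces_sub gF. Qed.

(** [X] holds the untouched triangles. The first condition on it makes [cd] a non-edge; the other
    two keep both old triangles out of [X], so that the set difference in [eflip] leaves exactly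
    [X]. *)
Lemma eflip_intro S S' X x y c d :
    S = [set [set x; y; c]; [set x; y; d]] :|: X ->
    S' = [set [set x; c; d]; [set y; c; d]] :|: X ->
    uniq [:: x; y; c; d] ->
    (forall g, g \in X -> [&& (c \notin g) || (d \notin g),
       [|| x \notin g, y \notin g | c \notin g] &
       [|| x \notin g, y \notin g | d \notin g]]) ->
  eflip S S'.
Proof.
move=> -> -> U HX; exists x, y, c, d.
have Uc : uniq [:: x; y; c] by apply/uniq_count => z; count_lia U z.
have Ud : uniq [:: x; y; d] by apply/uniq_count => z; count_lia U z.
have cd : c != d.
  apply/negP=> /eqP E; subst d; count_lia U c.
do 2?[split; first by apply/eqP; rewrite set3_card].
split=> //; split; first by rewrite !inE eqxx.
split; first by rewrite !inE eqxx orbT.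
split.
  apply/negP=> /edgebP[_ [g [gS cg dg]]]; move: gS; rewrite in_setU in_set2.
  case/orP=> [/orP[]/eqP E|/HX]; last by rewrite cg dg.
    by move: dg; rewrite E !inE ![d == _]eq_sym; count_lia U d.
  by move: cg; rewrite E !inE ![c == _]eq_sym; count_lia U c.
congr (_ :|: _); apply/setP=> g; rewrite !inE.
have [gX|] := boolP (g \in X); last by rewrite orbF andNb.
rewrite orbT andbT; apply/esym; apply/norP; split; apply/eqP=> E; move: (HX g gX);
  by rewrite E !inE !eqxx ?orbT /= ?andbF.
Qed.

(** [X] stands for everything outside the rotated tree. It may touch the base vertices but none of
    the labels, which is what lets the statement pass through contexts. *)
Lemma rotation_eflip t t' a b c X : rotation t t' ->
    uniq [:: a, b, c & labels t] ->
    (forall g z, g \in X -> z \in labels t -> z \notin g) ->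
  eflip (faces a b c t :|: X) (faces a b c t' :|: X).
Proof.
move=> r; elim: r a b c X => {t t'}.
- move=> v w Y V W a b c X U HX.
  apply: (@eflip_intro _ _ (faces a v c Y :|: faces a w v V :|: faces a b w W :|: X) b v c w).
  - rewrite /=; have -> : [set v; b; c] = [set b; v; c] by set3.
    have -> : [set w; b; v] = [set b; v; w] by set3.
    set_bool.
  - rewrite /=; have -> : [set w; b; c] = [set b; c; w] by set3.
    have -> : [set v; w; c] = [set v; c; w] by set3.
    set_bool.
  - by apply/uniq_count => z; count_lia U z.
  (* Each of the four parts misses one end of the old edge and one end of the new one, in all four
     combinations; this implies the three conditions. The same holds for [rot2] and [rot3]. *)
  move=> g; rewrite !in_setU => /orP[/orP[/orP[]|]|] gF.
  + have -> : b \notin g by apply: (faces_notin gF); count_lia U b.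
    have -> : w \notin g by apply: (faces_notin gF); count_lia U w.
    by rewrite !orbT.
  + have -> : b \notin g by apply: (faces_notin gF); count_lia U b.
    have -> : c \notin g by apply: (faces_notin gF); count_lia U c.
    by rewrite !orbT.
  + have -> : v \notin g by apply: (faces_notin gF); count_lia U v.
    have -> : c \notin g by apply: (faces_notin gF); count_lia U c.
    by rewrite !orbT.
  + have -> : v \notin g by apply: (HX _ _ gF); rewrite /= !inE eqxx.
    have -> : w \notin g by apply: (HX _ _ gF); rewrite /= !inE !mem_cat !inE eqxx !orbT.
    by rewrite !orbT.
- move=> v w X0 U0 W a b c X U HX.
  apply: (@eflip_intro _ _ (faces v b c X0 :|: faces w b v U0 :|: faces a b w W :|: X) a v c w).
  - rewrite /=; have -> : [set a; w; v] = [set a; v; w] by set3.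
    set_bool.
  - rewrite /=; have -> : [set a; w; c] = [set a; c; w] by set3.
    have -> : [set w; v; c] = [set v; c; w] by set3.
    set_bool.
  - by apply/uniq_count => z; count_lia U z.
  move=> g; rewrite !in_setU => /orP[/orP[/orP[]|]|] gF.
  + have -> : a \notin g by apply: (faces_notin gF); count_lia U a.
    have -> : w \notin g by apply: (faces_notin gF); count_lia U w.
    by rewrite !orbT.
  + have -> : a \notin g by apply: (faces_notin gF); count_lia U a.
    have -> : c \notin g by apply: (faces_notin gF); count_lia U c.
    by rewrite !orbT.
  + have -> : v \notin g by apply: (faces_notin gF); count_lia U v.
    have -> : c \notin g by apply: (faces_notin gF); count_lia U c.
    by rewrite !orbT.
  + have -> : v \notin g by apply: (HX _ _ gF); rewrite /= !inE eqxx.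
    have -> : w \notin g by apply: (HX _ _ gF); rewrite /= !inE !mem_cat !inE eqxx !orbT.
    by rewrite !orbT.
- move=> v w X0 U0 V a b c X U HX.
  apply: (@eflip_intro _ _ (faces v b c X0 :|: faces w v c U0 :|: faces a w c V :|: X) a v b w).
  - rewrite /=; have -> : [set a; b; v] = [set a; v; b] by set3.
    set_bool.
  - rewrite /=; have -> : [set w; b; v] = [set v; b; w] by set3.
    set_bool.
  - by apply/uniq_count => z; count_lia U z.
  move=> g; rewrite !in_setU => /orP[/orP[/orP[]|]|] gF.
  + have -> : a \notin g by apply: (faces_notin gF); count_lia U a.
    have -> : w \notin g by apply: (faces_notin gF); count_lia U w.
    by rewrite !orbT.
  + have -> : a \notin g by apply: (faces_notin gF); count_lia U a.
    have -> : b \notin g by apply: (faces_notin gF); count_lia U b.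
    by rewrite !orbT.
  + have -> : v \notin g by apply: (faces_notin gF); count_lia U v.
    have -> : b \notin g by apply: (faces_notin gF); count_lia U b.
    by rewrite !orbT.
  + have -> : v \notin g by apply: (HX _ _ gF); rewrite /= !inE eqxx.
    have -> : w \notin g by apply: (HX _ _ gF); rewrite /= !inE !mem_cat !inE eqxx !orbT.
    by rewrite !orbT.
- move=> v A A' B C _ IH a b c X U HX; have [UA _ _] := uniq_node U.
  (* The siblings of the rotated child are absorbed into [X]; likewise in the two remaining
     cases. *)
  rewrite /= -!setUA; apply: IH => // g z; rewrite !in_setU => /or3P[] gF zA.
  + by apply: (faces_notin gF); move: zA; count_lia U z.
  + by apply: (faces_notin gF); move: zA; count_lia U z.
  + by apply: (HX _ _ gF); rewrite /= !inE !mem_cat zA !orbT.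
- move=> v A B B' C _ IH a b c X U HX; have [_ UB _] := uniq_node U.
  rewrite /= ![faces v b c A :|: _]setUC -!setUA.
  apply: IH => // g z; rewrite !in_setU => /or3P[] gF zA.
  + by apply: (faces_notin gF); move: zA; count_lia U z.
  + by apply: (faces_notin gF); move: zA; count_lia U z.
  + by apply: (HX _ _ gF); rewrite /= !inE !mem_cat zA !orbT.
- move=> v A B C C' _ IH a b c X U HX; have [_ _ UC] := uniq_node U.
  rewrite /= ![faces v b c A :|: faces a v c B :|: _]setUC -!setUA.
  apply: IH => // g z; rewrite !in_setU => /or3P[] gF zA.
  + by apply: (faces_notin gF); move: zA; count_lia U z.
  + by apply: (faces_notin gF); move: zA; count_lia U z.
  + by apply: (HX _ _ gF); rewrite /= !inE !mem_cat zA !orbT.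
Qed.
End Geometry.

(** * Gluing a tree onto a ball; empty slots and free triangles *)

Section Gluing.
Variable T : finType.
Implicit Types (a b c p u v w x y z : T) (f g h : {set T}) (t A B C : tree T).
Implicit Types (K X : {set {set T}}).

Lemma star3 a b c v : uniq [:: a; b; c; v] ->
  star v [set a; b; c] = [set [set v; b; c]; [set a; v; c]; [set a; b; v]].
Proof.
move=> U; have vf : v \notin [set a; b; c].
  by rewrite !inE ![v == _]eq_sym; count_lia U v.
have [ab ac bc] : [/\ a == b = false, a == c = false & b == c = false].
  by move: U; rewrite /= !inE; case: (a == b); case: (a == c); case: (b == c) => //=;
     rewrite ?andbF.
have f3 : #|[set a; b; c]| = 3.
  by apply/eqP; rewrite set3_card /= !inE ab ac bc.
have Ea : v |: [set a; b; c] :\ a = [set v; b; c].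
  apply/setP=> z; rewrite !inE; case: (eqVneq z a) => [->|].
    by rewrite ab ac !orbF.
  by move=> _; do !case: (_ == _).
have Eb : v |: [set a; b; c] :\ b = [set a; v; c].
  apply/setP=> z; rewrite !inE; case: (eqVneq z b) => [->|].
    by rewrite [b == a]eq_sym ab bc !orbF.
  by move=> _; do !case: (_ == _).
have Ec : v |: [set a; b; c] :\ c = [set a; b; v].
  apply/setP=> z; rewrite !inE; case: (eqVneq z c) => [->|].
    by rewrite [c == a]eq_sym [c == b]eq_sym ac bc !orbF.
  by move=> _; do !case: (_ == _).
apply/setP=> g; rewrite [RHS]inE in_set2 in_set1; apply/idP/idP.
  move/(starP vf f3) => [w]; rewrite !inE => /orP[/orP[]|] /eqP-> ->.
  - by rewrite Ea eqxx. - by rewrite Eb eqxx orbT. - by rewrite Ec eqxx !orbT.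
case/orP=> [/orP[]|] /eqP->.
- by rewrite -Ea mem_star // !inE eqxx.
- by rewrite -Eb mem_star // !inE eqxx orbT.
- by rewrite -Ec mem_star // !inE eqxx !orbT.
Qed.

Lemma tets_sub a b c t g z : g \in tets a b c t -> z \in g ->
  z \in [:: a, b, c & labels t].
Proof.
elim: t a b c => [|v A IA B IB C IC] a b c /=; first by rewrite inE.
rewrite !in_setU in_set1 => /orP[/eqP->|/orP[/orP[]|]].
- rewrite !inE; lia.
- move/IA=> /[apply]; rewrite !inE !mem_cat; lia.
- move/IB=> /[apply]; rewrite !inE !mem_cat; lia.
- move/IC=> /[apply]; rewrite !inE !mem_cat; lia.
Qed.

Lemma vertsP K z : reflect (exists2 g, g \in K & z \in g) (z \in verts K).
Proof. by apply: (iffP bigcupP) => -[g]; exists g. Qed.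

Lemma verts_tets a b c t K z : z \in verts (tets a b c t :|: K) ->
  z \in [:: a, b, c & labels t] \/ z \in verts K.
Proof.
case/vertsP=> g; rewrite in_setU => /orP[/tets_sub gt /gt|gK zg]; first by left.
by right; apply/vertsP; exists g.
Qed.

Lemma neq_set g h z : z \notin g -> z \in h -> (h == g) = false.
Proof. by move=> zg zh; apply: contraNF zg => /eqP <-. Qed.

(** Gluing the root label over [abc] exposes the three triangles of [star3], which are the bases of
    the three children; these are then glued one after another, each to the ball obtained so far. *)
Lemma ball_glue_tree a b c t K : stacked_ball K -> [set a; b; c] \in boundary K ->
    uniq [:: a, b, c & labels t] -> (forall z, z \in labels t -> z \notin verts K) ->
  stacked_ball (tets a b c t :|: K) /\
  boundary (tets a b c t :|: K) = faces a b c t :|: boundary K :\ [set a; b; c].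
Proof.
elim: t a b c K => [|v A IA B IB C IC] a b c K sK abcK U HK.
  rewrite set0U; split=> //; by rewrite setD1K.
have [UA UB UC] := uniq_node U.
have vK : v \notin verts K by apply: HK; rewrite mem_head.
have bK : boundary ((v |: [set a; b; c]) |: K) =
    [set [set v; b; c]; [set a; v; c]; [set a; b; v]] :|: boundary K :\ [set a; b; c].
  rewrite boundary_glue // star3 //.
  by apply/uniq_count => z; count_lia U z.
have baseK z : z \in [:: a; b; c] -> z \in verts K.
  move=> zabc; apply: (subsetP (boundary_sub_verts abcK)).
  by move: zabc; rewrite !inE orbA.
have vbd g : v \in g -> g \notin boundary K.
  by move=> vg; apply: contra vK => /boundary_sub_verts/subsetP->.
set K1 := _ |: K in bK; have sK1 : stacked_ball K1 by apply: sb_glue.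
have vertsK1 z : z \in verts K1 -> z = v \/ z \in verts K.
  case/vertsP=> g; rewrite in_setU1 => /orP[/eqP->|gK zg].
    rewrite !inE => /orP[/eqP->|zabc]; first by left.
    by right; apply: baseK; rewrite !inE orbA.
  by right; apply/vertsP; exists g.
have notK z : z \in labels (Node v A B C) -> z != v -> z \notin verts K1.
  by move=> zl zv; apply/negP=> /vertsK1[/eqP|]; rewrite ?(negPf zv) ?(negPf (HK _ zl)).
have lab z : (z \in labels (Node v A B C)) =
    [|| z == v, z \in labels A, z \in labels B | z \in labels C].
  by rewrite inE !mem_cat.
have [avb abv] : a \notin [set v; b; c] /\ b \notin [set a; v; c].
  by rewrite !inE; split; [count_at U a|count_at U b];
     rewrite ![_ == a]eq_sym ![_ == b]eq_sym; clear; lia.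
have cab : c \notin [set a; b; v].
  by rewrite !inE; count_at U c; rewrite ![_ == c]eq_sym; clear; lia.
have n1 : [set a; v; c] != [set v; b; c] by rewrite (@neq_set _ _ a) // !inE eqxx.
have n2 : [set a; b; v] != [set v; b; c] by rewrite (@neq_set _ _ a) // !inE eqxx.
have n3 : [set a; b; v] != [set a; v; c].
  by rewrite (@neq_set _ _ b) // !inE eqxx orbT.
have [sK2 bK2] : stacked_ball (tets v b c A :|: K1) /\
    boundary (tets v b c A :|: K1) = faces v b c A :|: boundary K1 :\ [set v; b; c].
  apply: IA => //; first by rewrite bK !inE eqxx.
  move=> z zA; apply: notK; first by rewrite lab zA orbT.
  by apply/eqP=> E; subst z; move: zA; count_lia UA v.
set K2 := tets v b c A :|: K1 in sK2 bK2.
have [sK3 bK3] : stacked_ball (tets a v c B :|: K2) /\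
    boundary (tets a v c B :|: K2) = faces a v c B :|: boundary K2 :\ [set a; v; c].
  apply: IB => //.
    by rewrite bK2 bK !in_setU in_setD1 n1 !in_setU !in_set1 eqxx !orbT.
  move=> z zB; apply/negP=> /verts_tets[]; first by move: zB; count_lia U z.
  apply/negP/notK; first by rewrite lab zB !orbT.
  by apply/eqP=> E; subst z; move: zB; count_lia UB v.
set K3 := tets a v c B :|: K2 in sK3 bK3.
have [sK4 bK4] : stacked_ball (tets a b v C :|: K3) /\
    boundary (tets a b v C :|: K3) = faces a b v C :|: boundary K3 :\ [set a; b; v].
  apply: IC => //.
    by rewrite bK3 bK2 bK !in_setU !in_setD1 n3 !in_setU !in_setD1 n2 !in_setU !in_set1 eqxx !orbT.
  move=> z zC; apply/negP=> /verts_tets[]; first by move: zC; count_lia U z.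
  move=> /verts_tets[]; first by move: zC; count_lia U z.
  apply/negP/notK; first by rewrite lab zC !orbT.
  by apply/eqP=> E; subst z; move: zC; count_lia UC v.
have -> : tets a b c (Node v A B C) :|: K = tets a b v C :|: K3.
  rewrite /K3 /K2 /K1 /=; set_bool.
split=> //; rewrite bK4 bK3 bK2 bK /=; apply/setP=> g.
rewrite !(in_setU, in_setD1, in_set1).
(* Deleting the base of a later child must not remove triangles of an earlier one: those of [A]
   avoid [a] and those of [B] avoid [b], whereas the later bases contain these vertices. *)
have nA : g \in faces v b c A -> a \notin g.
  by move=> gF; apply: (faces_notin gF); count_lia U a.
have nB : g \in faces a v c B -> b \notin g.
  by move=> gF; apply: (faces_notin gF); count_lia U b.
have [E1|_] := eqVneq g [set v; b; c].
  have /negPf-> : g \notin boundary K by apply: vbd; rewrite E1 !inE eqxx.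
  have -> : (g == [set a; v; c]) = false by rewrite E1 eq_sym; apply: negPf.
  have -> : (g == [set a; b; v]) = false by rewrite E1 eq_sym; apply: negPf.
  by rewrite !andbF !orbF /=; do !case: (g \in _).
have [E1|_] := eqVneq g [set a; v; c].
  have /negPf-> : g \notin boundary K by apply: vbd; rewrite E1 !inE eqxx orbT.
  have /negPf-> : g \notin faces v b c A by apply/negP=> /nA; rewrite E1 !inE eqxx.
  have -> : (g == [set a; b; v]) = false by rewrite E1 eq_sym; apply: negPf.
  by rewrite !andbF !orbF /= orbC.
have [E1|_] := eqVneq g [set a; b; v].
  have /negPf-> : g \notin boundary K by apply: vbd; rewrite E1 !inE eqxx orbT.
  have /negPf-> : g \notin faces v b c A by apply/negP=> /nA; rewrite E1 !inE eqxx.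
  have /negPf-> : g \notin faces a v c B.
    by apply/negP=> /nB; rewrite E1 !inE eqxx orbT.
  by rewrite !andbF !orbF.
by rewrite /=; do !case: (g \in _) => //=; rewrite ?orbT ?orbF.
Qed.

Lemma good_tets a b c t g : good t -> g \in tets a b c t ->
  exists2 f, f \in faces a b c t & f \subset g.
Proof.
elim: t a b c => [|v A IA B IB C IC] a b c /=; first by rewrite inE.
case/and4P=> leaf gA gB gC; rewrite !in_setU in_set1 => /orP[/eqP->|/orP[/orP[]|]].
- case/or3P: leaf => [{IA gA}|{IB gB}|{IC gC}].
  + case: A => // _; exists [set v; b; c]; first by rewrite !inE eqxx.
    by apply/subsetP=> z; rewrite !inE; do !case: (_ == _).
  + case: B => // _; exists [set a; v; c]; first by rewrite !inE eqxx orbT.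
    by apply/subsetP=> z; rewrite !inE; do !case: (_ == _).
  + case: C => // _; exists [set a; b; v]; first by rewrite !inE eqxx !orbT.
    by apply/subsetP=> z; rewrite !inE; do !case: (_ == _).
- by case/(IA _ _ _ gA)=> f fF fg; exists f; rewrite // !in_setU fF.
- by case/(IB _ _ _ gB)=> f fF fg; exists f; rewrite // !in_setU fF orbT.
- by case/(IC _ _ _ gC)=> f fF fg; exists f; rewrite // !in_setU fF orbT.
Qed.

(** A free triangle of the root tetrahedron taken from [X] would avoid [v], hence be [abc], which is
    excluded. One from a nonempty child would contain a label of that child, which is not a vertex
    of the tetrahedron. So it comes from an empty slot. For the children, [X] grows by the siblings'
    triangles. *)
Lemma tets_good a b c t X : uniq [:: a, b, c & labels t] ->
    (forall f, f \in X -> #|f| = 3) ->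
    (forall f z, f \in X -> z \in labels t -> z \notin f) ->
    [set a; b; c] \notin X ->
    (forall g, g \in tets a b c t ->
       exists2 f, f \in faces a b c t :|: X & f \subset g) ->
  good t.
Proof.
elim: t a b c X => [//|v A IA B IB C IC] a b c X U X3 HX abcX Ht.
have [UA UB UC] := uniq_node U.
have lab z : (z \in labels (Node v A B C)) =
    [|| z == v, z \in labels A, z \in labels B | z \in labels C].
  by rewrite inE !mem_cat.
apply/and4P; split.
- have [|f] := Ht (v |: [set a; b; c]); first by rewrite /= !in_setU set11.
  rewrite /= !in_setU => /orP[fF|fX] /subsetP fg; last first.
    case/negP: abcX; suff <- : f = [set a; b; c] by [].
    apply/eqP; rewrite -(@sub_glue _ v).
    + exact/subsetP.
    + by apply: (HX _ _ fX); rewrite lab eqxx.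
    + exact: X3.
    + by apply/eqP; rewrite set3_card; apply/uniq_count => z; count_lia U z.
  apply: contraLR fF; rewrite !negb_or => /and3P[lA lB lC].
  rewrite -!andbA; apply/and3P; split; apply/negP=> fF.
  + have [E|[z zA zf]] := faces_new UA fF; first by rewrite E in lA.
    by have := fg z zf; move: zA; rewrite !inE ![z == _]eq_sym; count_lia U z.
  + have [E|[z zA zf]] := faces_new UB fF; first by rewrite E in lB.
    by have := fg z zf; move: zA; rewrite !inE ![z == _]eq_sym; count_lia U z.
  + have [E|[z zA zf]] := faces_new UC fF; first by rewrite E in lC.
    by have := fg z zf; move: zA; rewrite !inE ![z == _]eq_sym; count_lia U z.
- apply: (IA v b c (faces a v c B :|: faces a b v C :|: X)) => //.
  + move=> f; rewrite !in_setU => /orP[/orP[]|/X3 //].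
      exact: faces_card. exact: faces_card.
  + move=> f z; rewrite !in_setU => /orP[/orP[]|] fF zA.
    * by apply: (faces_notin fF); move: zA; count_lia U z.
    * by apply: (faces_notin fF); move: zA; count_lia U z.
    * by apply: (HX _ _ fF); rewrite lab zA !orbT.
  + rewrite !in_setU; apply/negP=> /orP[/orP[]|] fF.
    * have /negP[] : b \notin [set v; b; c] by apply: (faces_notin fF); count_lia U b.
      by rewrite !inE eqxx orbT.
    * have /negP[] : c \notin [set v; b; c] by apply: (faces_notin fF); count_lia U c.
      by rewrite !inE eqxx orbT.
    * have /negP[] : v \notin [set v; b; c] by apply: (HX _ _ fF); rewrite lab eqxx.
      by rewrite !inE eqxx.
  + move=> g gA; have [|f fF fg] := Ht g; first by rewrite /= !in_setU gA orbT.
    by exists f => //; rewrite !setUA.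
- apply: (IB a v c (faces v b c A :|: faces a b v C :|: X)) => //.
  + move=> f; rewrite !in_setU => /orP[/orP[]|/X3 //].
      exact: faces_card. exact: faces_card.
  + move=> f z; rewrite !in_setU => /orP[/orP[]|] fF zA.
    * by apply: (faces_notin fF); move: zA; count_lia U z.
    * by apply: (faces_notin fF); move: zA; count_lia U z.
    * by apply: (HX _ _ fF); rewrite lab zA !orbT.
  + rewrite !in_setU; apply/negP=> /orP[/orP[]|] fF.
    * have /negP[] : a \notin [set a; v; c] by apply: (faces_notin fF); count_lia U a.
      by rewrite !inE eqxx.
    * have /negP[] : c \notin [set a; v; c] by apply: (faces_notin fF); count_lia U c.
      by rewrite !inE eqxx orbT.
    * have /negP[] : v \notin [set a; v; c] by apply: (HX _ _ fF); rewrite lab eqxx.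
      by rewrite !inE eqxx orbT.
  + move=> g gA; have [|f fF fg] := Ht g; first by rewrite /= !in_setU gA !orbT.
    by exists f => //; move: fF; rewrite /= !in_setU; do !case: (f \in _).
- apply: (IC a b v (faces v b c A :|: faces a v c B :|: X)) => //.
  + move=> f; rewrite !in_setU => /orP[/orP[]|/X3 //].
      exact: faces_card. exact: faces_card.
  + move=> f z; rewrite !in_setU => /orP[/orP[]|] fF zA.
    * by apply: (faces_notin fF); move: zA; count_lia U z.
    * by apply: (faces_notin fF); move: zA; count_lia U z.
    * by apply: (HX _ _ fF); rewrite lab zA !orbT.
  + rewrite !in_setU; apply/negP=> /orP[/orP[]|] fF.
    * have /negP[] : a \notin [set a; b; v] by apply: (faces_notin fF); count_lia U a.
      by rewrite !inE eqxx.
    * have /negP[] : b \notin [set a; b; v] by apply: (faces_notin fF); count_lia U b.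
      by rewrite !inE eqxx orbT.
    * have /negP[] : v \notin [set a; b; v] by apply: (HX _ _ fF); rewrite lab eqxx.
      by rewrite !inE eqxx orbT.
  + move=> g gA; have [|f fF fg] := Ht g; first by rewrite /= !in_setU gA !orbT.
    by exists f => //; move: fF; rewrite /= !in_setU; do !case: (f \in _).
Qed.
End Gluing.

(** * Every stacked ball as a rooted tree *)

Section Rooting.
Variable T : finType.
Implicit Types (a b c p u v w x y z : T) (f g h : {set T}) (t A B C : tree T).
Implicit Types (K X : {set {set T}}).

(** Two children have only two vertices in common, too few for a triangle. Hence removing [f] from
    one child leaves the others intact. *)
Lemma node_faces_disjoint a b c u A B C f :
    uniq [:: a, b, c & labels (Node u A B C)] ->
  [/\ f \in faces u b c A -> f \notin faces a u c B,
      f \in faces u b c A -> f \notin faces a b u C &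
      f \in faces a u c B -> f \notin faces a b u C].
Proof.
move=> U; have [UA UB UC] := uniq_node U.
have small x y : #|f| = 3 -> f \subset [set x; y] -> False.
  by move=> f3 /subset_leq_card; rewrite f3 cards2; case: (_ != _).
split=> fA; apply/negP=> fB.
- apply: (small u c (faces_card UA fA)); apply/subsetP=> z zf.
  move: (faces_sub fA zf) (faces_sub fB zf).
  by rewrite [z \in [set _; _]]inE ![z \in [set _]]inE ![z == _]eq_sym; count_lia U z.
- apply: (small u b (faces_card UA fA)); apply/subsetP=> z zf.
  move: (faces_sub fA zf) (faces_sub fB zf).
  by rewrite [z \in [set _; _]]inE ![z \in [set _]]inE ![z == _]eq_sym; count_lia U z.
- apply: (small u a (faces_card UB fA)); apply/subsetP=> z zf.
  move: (faces_sub fA zf) (faces_sub fB zf).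
  by rewrite [z \in [set _; _]]inE ![z \in [set _]]inE ![z == _]eq_sym; count_lia U z.
Qed.

(** The empty slot over [f] receives the node [v]. The new label lands somewhere inside the label
    list, so labels are compared by multiplicity. *)
Lemma faces_extend a b c t f v : uniq [:: a, b, c & labels t] ->
    f \in faces a b c t -> v \notin [:: a, b, c & labels t] ->
  exists t', [/\ ~~ is_leaf t',
    faces a b c t' = star v f :|: faces a b c t :\ f &
    forall z, count_mem z (labels t') = (v == z) + count_mem z (labels t)].
Proof.
elim: t a b c => [|u A IA B IB C IC] a b c U.
  rewrite inE => /eqP-> vabc; exists (Node v Leaf Leaf Leaf).
  have U' : uniq [:: v; a; b; c] by rewrite cons_uniq vabc.
  split=> //=; rewrite star3 ?setDv ?setU0 //.
  by apply/uniq_count => z; count_lia U' z.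
have [UA UB UC] := uniq_node U; have [dAB dAC dBC] := node_faces_disjoint f U.
move=> fF vN.
have [vA vB vC] : [/\ v \notin [:: u, b, c & labels A],
    v \notin [:: a, u, c & labels B] & v \notin [:: a, b, u & labels C]].
  by split; apply: contra vN; rewrite /= !inE !mem_cat; clear; lia.
move: fF; rewrite /= !in_setU => /orP[/orP[]|] fF.
- have [t' [_ Ft' ct']] := IA _ _ _ UA fF vA.
  exists (Node u t' B C); split=> // [|z]; last first.
    by rewrite /= !count_cat ct' -addnA addnCA.
  rewrite /= Ft'; apply/setP=> g; rewrite !(in_setU, in_setD1).
  have [->|_] := eqVneq g f; last by do !case: (g \in _).
  by rewrite (negPf (dAB fF)) (negPf (dAC fF)) !orbF.
- have [t' [_ Ft' ct']] := IB _ _ _ UB fF vB.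
  exists (Node u A t' C); split=> // [|z]; last first.
    by rewrite /= !count_cat ct' -addnA [_ + (nat_of_bool (v == z) + _)]addnCA addnCA.
  rewrite /= Ft'; apply/setP=> g; rewrite !(in_setU, in_setD1).
  have [->|_] := eqVneq g f; last by do !case: (g \in _).
  by rewrite (negPf (dBC fF)) (negPf (contraL dAB fF)) !orbF.
- have [t' [_ Ft' ct']] := IC _ _ _ UC fF vC.
  exists (Node u A B t'); split=> // [|z]; last first.
    by rewrite /= !count_cat ct' ![_ + (nat_of_bool (v == z) + _)]addnCA.
  rewrite /= Ft'; apply/setP=> g; rewrite !(in_setU, in_setD1).
  have [->|_] := eqVneq g f; last by do !case: (g \in _).
  by rewrite (negPf (contraL dBC fF)) (negPf (contraL dAC fF)).
Qed.

Lemma boundary_tet f v : #|f| = 3 -> v \notin f ->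
  boundary [set v |: f] = f |: star v f.
Proof.
move=> f3 vf; apply/setP=> g; rewrite !inE.
have -> : (#|[set t in [set v |: f] | g \subset t]| == 1) = (g \subset v |: f).
  have [gf|gf] := boolP (g \subset _).
    by apply/cards1P; exists (v |: f); apply/setP=> t; rewrite !inE; case: eqP => // ->.
  rewrite (_ : #|_| = 0) //; apply: eq_card0 => t; rewrite !inE.
  by case: eqP => // ->; rewrite (negPf gf).
have [vg|vg] := boolP (v \in g).
  by rewrite (_ : (g == f) = false) //; apply: contraNF vf => /eqP <-.
have [g3|g3] := eqVneq #|g| 3; first by rewrite (sub_glue vg g3 f3) orbF.
by rewrite /= orbF; apply/esym; apply: contraNF g3 => /eqP->; rewrite f3.
Qed.

Lemma eq_set3 f x y z : #|f| = 3 -> uniq [:: x; y; z] ->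
  x \in f -> y \in f -> z \in f -> f = [set x; y; z].
Proof.
move=> f3 U xf yf zf; apply/eqP; rewrite eq_sym eqEcard f3.
rewrite -set3_card in U; rewrite (eqP U) andbT.
by apply/subsetP=> w; rewrite !inE => /orP[/orP[]|] /eqP->.
Qed.

Lemma set3P f : #|f| = 3 -> exists a b c, uniq [:: a; b; c] /\ f = [set a; b; c].
Proof.
move=> f3; have := enum_uniq f; have : size (enum f) = 3 by rewrite -cardE.
case E : (enum f) => [|a [|b [|c []]]] //= _ U; exists a, b, c; split=> //.
by apply: eq_set3; rewrite // -mem_enum E !inE eqxx ?orbT.
Qed.

(** Any boundary triangle may serve as base. If [abc] predates the last vertex [v], the older tree
    is extended at [f]. If [abc] contains [v], the last tetrahedron becomes the top node, and the
    older ball, rooted at [f] by induction, hangs below it. *)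
Lemma ball_tree K a b c : stacked_ball K -> [set a; b; c] \in boundary K ->
  exists t, [/\ ~~ is_leaf t, uniq [:: a, b, c & labels t],
    boundary K = [set a; b; c] |: faces a b c t &
    forall z, z \in [:: a, b, c & labels t] -> z \in verts K].
Proof.
move=> sK; elim: sK a b c => {K} [t t4|K f v sK IH fK vK] a b c abcK.
  have [abc3 [_ /set1P-> abct]] := boundaryP abcK.
  have [v /setDP[vt vabc]] : exists v, v \in t :\: [set a; b; c].
    by apply/card_gt0P; rewrite cardsD (setIidPr abct) t4 abc3.
  have tE : t = v |: [set a; b; c].
    apply/eqP; rewrite eq_sym eqEcard cardsU1 vabc abc3 t4 andbT.
    by apply/subsetP=> z /setU1P[->|/(subsetP abct)].
  have U : uniq [:: a; b; c; v].
    have U' : uniq [:: v; a; b; c].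
      by rewrite cons_uniq -set3_card abc3 andbT; move: vabc; rewrite !inE orbA.
    by apply/uniq_count => z; count_lia U' z.
  exists (Node v Leaf Leaf Leaf); split=> //.
    by rewrite tE boundary_tet // star3.
  move=> z zl; apply/vertsP; exists t; rewrite ?set11 // tE !inE.
  by move: zl; rewrite !inE; do !case: (_ == _).
have [f3 _] := boundaryP fK.
have vf : v \notin f by apply: contra vK; apply: (subsetP (boundary_sub_verts fK)).
have [abc3 _] := boundaryP abcK.
have Uabc : uniq [:: a; b; c] by rewrite -set3_card abc3.
have vertsS z : z \in verts K -> z \in verts ((v |: f) |: K).
  by case/vertsP=> g gK zg; apply/vertsP; exists g; rewrite // in_setU gK orbT.
have vvS : v \in verts ((v |: f) |: K).
  by apply/vertsP; exists (v |: f); rewrite !inE eqxx.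
move: abcK; rewrite boundary_glue // in_setU in_setD1 => /orP[]; last first.
  case/andP=> abcf /IH[t [nt U bK lK]].
  have ft : f \in faces a b c t by move: fK; rewrite bK in_setU1 eq_sym (negPf abcf).
  have vt : v \notin [:: a, b, c & labels t] by apply: contra vK => /lK.
  have [t' [nt' Ft' ct']] := faces_extend U ft vt.
  have ct z : count_mem z [:: a, b, c & labels t'] =
      (v == z) + count_mem z [:: a, b, c & labels t].
    by rewrite /= ct' ![_ + (nat_of_bool (v == z) + _)]addnCA.
  exists t'; split=> //.
  - apply/uniq_count => z; rewrite ct; have := proj1 (uniq_count _) U z.
    have [<- _|_ //] := eqVneq v z.
    by move: vt; rewrite mem_count; case: (count_mem _ _).
  - rewrite bK Ft'; apply/setP=> g; rewrite !(in_setU, in_setD1, in_set1).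
    have [->|_] := eqVneq g [set a; b; c]; last by do !case: (g \in _).
    by rewrite abcf orbT.
  - move=> z; rewrite mem_count ct; have [<- //|_] := eqVneq v z.
    by rewrite -mem_count => /lK/vertsS.
(* [w] is the vertex of [f] missing from [abc]; it becomes the label of the top node. *)
case/(starP vf f3)=> w wf abcE.
have fabc z : z \in [set a; b; c] -> z != v -> z \in f.
  by rewrite abcE in_setU1 in_setD1 => /orP[->|/andP[]].
have wabc : w \notin [set a; b; c].
  by rewrite abcE !inE eqxx orbF; apply: contraNneq vf => <-.
have vabc : v \in [set a; b; c] by rewrite abcE !inE eqxx.
move: wabc; rewrite !inE !negb_or -andbA => /and3P[wa wb wc].
have {abcE} root x y z (fE : f = [set x; y; z]) :
    exists t, [/\ uniq [:: v, x, y, z & labels t],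
      star v f :|: boundary K :\ f = star v f :|: faces x y z t &
      forall u, u \in [:: x, y, z & labels t] -> u \in verts K].
  have xyzK : [set x; y; z] \in boundary K by rewrite -fE.
  have [t [nt U bK lK]] := IH x y z xyzK.
  exists t; split=> //.
    by rewrite cons_uniq U andbT; apply: contra vK => /lK.
  (* Removing [f] deletes only the base: a nonempty tree has a label in each of its triangles, so
     [f] is not among them. *)
  rewrite bK fE setU1K //.
  apply/negP=> /(faces_new U)[E|[u ut]]; first by rewrite E in nt.
  by rewrite !inE ![u == _]eq_sym => uxyz; move: ut uxyz; count_lia U u.
have [ab ac bc] : [/\ a != b, a != c & b != c].
  by move: Uabc; rewrite /= !inE !negb_or andbT => /andP[/andP[]].
(* The slot that replaces [v] by [w] has base [f] and receives the older ball; the other two stay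
   empty. *)
move: vabc; rewrite !inE => /orP[/orP[]|] /eqP vE; subst v.
- have fE : f = [set w; b; c].
    apply: eq_set3 => //; first by rewrite /= !inE !negb_or wb wc bc.
    + by apply: fabc; rewrite ?inE ?eqxx ?orbT // eq_sym.
    + by apply: fabc; rewrite ?inE ?eqxx ?orbT // eq_sym.
  have [t [U bK lK]] := root _ _ _ fE.
  exists (Node w t Leaf Leaf); split=> //.
  + by apply/uniq_count => z; count_lia U z.
  + rewrite bK fE star3; last by apply/uniq_count => z; count_lia U z.
    have -> : [set w; a; c] = [set a; w; c] by set3.
    have -> : [set w; b; a] = [set a; b; w] by set3.
    rewrite /=; set_bool.
  + move=> z zl; have [-> //|za] := eqVneq z a; apply/vertsS/lK.
    by move: zl; rewrite /= cats0 !inE (negPf za) /=;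
      move/or4P=> [] ->; rewrite ?orbT.
- have fE : f = [set a; w; c].
    apply: eq_set3 => //; first by rewrite /= !inE !negb_or [a == w]eq_sym wa ac wc.
    + by apply: fabc; rewrite ?inE ?eqxx ?orbT.
    + by apply: fabc; rewrite ?inE ?eqxx ?orbT // eq_sym.
  have [t [U bK lK]] := root _ _ _ fE.
  exists (Node w Leaf t Leaf); split=> //.
  + by apply/uniq_count => z; count_lia U z.
  + rewrite bK fE star3; last by apply/uniq_count => z; count_lia U z.
    have -> : [set b; w; c] = [set w; b; c] by set3.
    have -> : [set a; w; b] = [set a; b; w] by set3.
    rewrite /=; set_bool.
  + move=> z zl; have [-> //|za] := eqVneq z b; apply/vertsS/lK.
    by move: zl; rewrite /= cats0 !inE (negPf za) /=;
      move/or4P=> [] ->; rewrite ?orbT.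
- have fE : f = [set a; b; w].
    apply: eq_set3 => //.
      by rewrite /= !inE !negb_or [a == w]eq_sym [b == w]eq_sym wa wb ab.
    + by apply: fabc; rewrite ?inE ?eqxx ?orbT.
    + by apply: fabc; rewrite ?inE ?eqxx ?orbT.
  have [t [U bK lK]] := root _ _ _ fE.
  exists (Node w Leaf Leaf t); split=> //.
  + by apply/uniq_count => z; count_lia U z.
  + rewrite bK fE star3; last by apply/uniq_count => z; count_lia U z.
    have -> : [set c; b; w] = [set w; b; c] by set3.
    have -> : [set a; c; w] = [set a; w; c] by set3.
    rewrite /=; set_bool.
  + move=> z zl; have [-> //|za] := eqVneq z c; apply/vertsS/lK.
    by move: zl; rewrite /= !inE (negPf za) /=;
      move/or4P=> [] ->; rewrite ?orbT.
Qed.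

(* Boundary of the tetrahedron [pabc] with the tree [t] glued on its face [abc]. *)
Definition sphere p a b c t : {set {set T}} :=
  faces a b c t :|: [set [set p; b; c]; [set a; p; c]; [set a; b; p]].

(** The vertex glued last serves as [p]: its tetrahedron meets the rest only along the triangle it
    was glued on. *)
Lemma ball_sphere K : stacked_ball K -> exists p a b c t,
  uniq [:: p, a, b, c & labels t] /\ boundary K = sphere p a b c t.
Proof.
case=> {K} [t t4|K f v sK fK vK].
  have /card_gt0P[p pt] : 0 < #|t| by rewrite t4.
  have [|a [b [c [U tE]]]] := @set3P (t :\ p).
    by move: (cardsD1 p t); rewrite pt t4 => -[].
  have pabc : p \notin [set a; b; c] by rewrite -tE !inE eqxx.
  have U' : uniq [:: p, a, b, c & [::]].
    by rewrite cons_uniq U andbT; move: pabc; rewrite !inE orbA.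
  exists p, a, b, c, Leaf; split=> //.
  rewrite -(setD1K pt) tE boundary_tet //; last first.
    by apply/eqP; rewrite set3_card.
  by rewrite star3 //; apply/uniq_count => z; count_lia U' z.
have [f3 _] := boundaryP fK; have [a [b [c [U fE]]]] := set3P f3; subst f.
have [t [nt Ut bK lK]] := ball_tree sK fK.
have U' : uniq [:: v, a, b, c & labels t].
  by rewrite cons_uniq Ut andbT; apply: contra vK => /lK.
exists v, a, b, c, t; split=> //.
rewrite boundary_glue // star3; last by apply/uniq_count => z; count_lia U' z.
rewrite bK setU1K 1?setUC //.
apply/negP=> /(faces_new Ut)[E|[u ut]]; first by rewrite E in nt.
by rewrite !inE ![u == _]eq_sym => uxyz; move: ut uxyz; count_lia U' u.
Qed.

Lemma sphere_ball p a b c t : uniq [:: p, a, b, c & labels t] ->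
  stacked_ball (tets a b c t :|: [set p |: [set a; b; c]]) /\
  boundary (tets a b c t :|: [set p |: [set a; b; c]]) = sphere p a b c t.
Proof.
move=> U; have U4 : uniq [:: a; b; c; p].
  by apply/uniq_count => z; count_lia U z.
have pabc : p \notin [set a; b; c].
  by rewrite !inE ![p == _]eq_sym; count_lia U p.
have abc3 : #|[set a; b; c]| = 3.
  by apply/eqP; rewrite set3_card; apply/uniq_count => z; count_lia U z.
have bd := boundary_tet abc3 pabc; rewrite star3 // in bd.
have [||||s1 s2] := @ball_glue_tree _ a b c t [set p |: [set a; b; c]].
- by apply: sb_tet; rewrite cardsU1 pabc abc3.
- by rewrite bd setU11.
- by case/andP: U.
- move=> z zt; apply/negP=> /vertsP[g /set1P->]; move: zt.
  by rewrite !inE ![z == _]eq_sym; count_lia U z.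
split=> //; rewrite s2 bd setU1K // !inE !negb_or.
have neq g : p \in g -> [set a; b; c] != g.
  by move=> pg; apply: contraNneq pabc => ->.
by rewrite !neq // !inE eqxx ?orbT.
Qed.
End Rooting.

(** * Relabelling, and a flip involving the root tetrahedron *)

Fixpoint tree_map (T1 T2 : Type) (f : T1 -> T2) (t : tree T1) : tree T2 :=
  if t is Node v A B C then Node (f v) (tree_map f A) (tree_map f B) (tree_map f C)
  else Leaf.

Lemma labels_map (T1 T2 : Type) (f : T1 -> T2) t :
  labels (tree_map f t) = map f (labels t).
Proof. by elim: t => //= v A -> B -> C ->; rewrite !map_cat. Qed.

Lemma imset_set3 (T1 T2 : finType) (f : T1 -> T2) a b c :
  f @: [set a; b; c] = [set f a; f b; f c].
Proof. by rewrite !imsetU !imset_set1. Qed.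

Lemma faces_map (T1 T2 : finType) (f : T1 -> T2) t a b c :
  faces (f a) (f b) (f c) (tree_map f t) = [set f @: g | g : {set T1} in faces a b c t].
Proof.
elim: t a b c => [|v A IA B IB C IC] a b c /=.
  by rewrite imset_set1 imset_set3.
by rewrite IA IB IC !imsetU.
Qed.

Lemma sphere_map (T1 T2 : finType) (f : T1 -> T2) p a b c t :
  sphere (f p) (f a) (f b) (f c) (tree_map f t)
  = [set f @: g | g : {set T1} in sphere p a b c t].
Proof. by rewrite /sphere faces_map !imsetU !imset_set1 !imset_set3. Qed.

Lemma verts_sphere (T : finType) (p a b c : T) t z :
  z \in verts (sphere p a b c t) = (z \in [:: p, a, b, c & labels t]).
Proof.
apply/vertsP/idP => [[g]|].
  rewrite in_setU => /orP[gF zg|]; first by rewrite inE (faces_sub gF zg) orbT.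
  by rewrite !inE => /orP[/orP[]|] /eqP->; rewrite !inE => /orP[/orP[]|] ->; rewrite ?orbT.
rewrite inE (mem_cat z [:: a; b; c] (labels t)) => /or3P[/eqP->|zabc|zt].
- by exists [set p; b; c]; rewrite ?inE ?eqxx ?orbT.
- have [g gF zg] := base_in_faces t zabc.
  by exists g; rewrite // in_setU gF.
- have [g gF zg] := label_in_faces a b c zt.
  by exists g; rewrite // in_setU gF.
Qed.

Lemma cx_iso_id (T : finType) (K : {set {set T}}) : cx_iso K K.
Proof.
exists id; split=> [x y _ _ //|].
by apply/setP=> g; apply/idP/imsetP => [gK|[h hK ->]];
  [exists g; rewrite ?imset_id|rewrite imset_id].
Qed.

Lemma outer_fresh (T : finType) (p a b c : T) t (g : {set T}) z :
    uniq [:: p, a, b, c & labels t] ->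
    g \in [set [set p; b; c]; [set a; p; c]; [set a; b; p]] ->
  z \in labels t -> z \notin g.
Proof.
move=> U + zt; rewrite !inE => /orP[/orP[]|] /eqP->; move: zt;
  by rewrite !inE ![z == _]eq_sym; count_lia U z.
Qed.

(** The flip replaces [bc] by [pv], turning the tetrahedra [pabc], [vabc] into [capv], [bapv].
    Taking [c] as the new apex and [b] as the new top label keeps [C] over the ordered triple [a],
    [b], [v]. *)
Lemma sphere_flip (T : finType) (p a b c v : T) C :
    uniq [:: p, a, b, c & labels (Node v Leaf Leaf C)] ->
  uniq [:: c, a, p, v & labels (Node b Leaf C Leaf)] /\
  eflip (sphere p a b c (Node v Leaf Leaf C)) (sphere c a p v (Node b Leaf C Leaf)).
Proof.
move=> U; split.
  by apply/uniq_count => z; count_lia U z.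
apply: (@eflip_intro _ _ _ (faces a b v C :|:
   [set [set a; v; c]; [set a; p; c]; [set a; b; p]]) b c p v).
- rewrite /sphere /=; have -> : [set p; b; c] = [set b; c; p] by set3.
  have -> : [set v; b; c] = [set b; c; v] by set3.
  set_bool.
- rewrite /sphere /=.
  have -> : [set a; c; v] = [set a; v; c] by set3.
  have -> : [set a; p; b] = [set a; b; p] by set3.
  set_bool.
- by apply/uniq_count => z; count_lia U z.
move=> g; rewrite in_setU => /orP[gF|].
  have -> : p \notin g by apply: (faces_notin gF); count_lia U p.
  have -> : c \notin g by apply: (faces_notin gF); count_lia U c.
  by rewrite !orbT.
rewrite !inE => /orP[/orP[]|] /eqP->.
- have -> : p \notin [set a; v; c].
    by rewrite !inE ![p == _]eq_sym; count_lia U p.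
  have -> : b \notin [set a; v; c].
    by rewrite !inE ![b == _]eq_sym; count_lia U b.
  by [].
- have -> : v \notin [set a; p; c].
    by rewrite !inE ![v == _]eq_sym; count_lia U v.
  have -> : b \notin [set a; p; c].
    by rewrite !inE ![b == _]eq_sym; count_lia U b.
  by rewrite !orbT.
- have -> : v \notin [set a; b; p].
    by rewrite !inE ![v == _]eq_sym; count_lia U v.
  have -> : c \notin [set a; b; p].
    by rewrite !inE ![c == _]eq_sym; count_lia U c.
  by rewrite !orbT.
Qed.

Lemma sphere_good (T : finType) (p a b c : T) t :
  uniq [:: p, a, b, c & labels t] -> no_deg4 (sphere p a b c t) -> good t.
Proof.
move=> U; have [sB <-] := sphere_ball U => /(no_deg4_boundary sB) nd.
rewrite (proj2 (sphere_ball U)) in nd.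
apply: (@tets_good _ a b c t [set [set p; b; c]; [set a; p; c]; [set a; b; p]]).
- by case/andP: U.
- move=> g; rewrite !inE => /orP[/orP[]|] /eqP->; apply/eqP; rewrite set3_card;
    by apply/uniq_count => z; count_lia U z.
- by move=> g z; apply: outer_fresh U.
- have pabc : p \notin [set a; b; c].
    by rewrite !inE ![p == _]eq_sym; count_lia U p.
  have neq (g : {set T}) : p \in g -> [set a; b; c] != g.
    by move=> pg; apply: contraNneq pabc => ->.
  by rewrite !inE !negb_or !neq // !inE eqxx ?orbT.
- by move=> g gt; apply: nd; rewrite in_setU gt.
Qed.

(** * Nodes of the graph and paths between them *)

Section Nodes.
Variable n : nat.
Implicit Types (p a b c v x y z : 'I_n) (t : tree 'I_n) (S X Y : {set {set 'I_n}}).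

Definition good_sphere p a b c t : Prop :=
  [/\ uniq [:: p, a, b, c & labels t], size (labels t) + 4 = n & good t].

Lemma good_sphere_node p a b c t : good_sphere p a b c t ->
  S0_node (sphere p a b c t).
Proof.
case=> U sz gt; have [sB bB] := sphere_ball U; split; [|split].
- apply/setP=> z; rewrite verts_sphere in_setT.
  have : #|[:: p, a, b, c & labels t]| = #|'I_n|.
    by rewrite (card_uniqP U) card_ord /=; lia.
  by move=> E; rewrite (elimT (subset_cardP E) (subset_predT _)).
- exists 'I_n, (tets a b c t :|: [set p |: [set a; b; c]]).
  by split; rewrite ?bB; last exact: cx_iso_id.
- rewrite -bB; apply/no_deg4_boundary => // g; rewrite bB in_setU in_set1.
  case/orP=> [/(good_tets gt)[f fF fg]|/eqP->].
    by exists f; rewrite // in_setU fF.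
  (* The root tetrahedron always has a free face. *)
  exists [set p; b; c]; first by rewrite !inE eqxx ?orbT.
  by apply/subsetP=> z; rewrite !inE => /orP[/orP[]|] ->; rewrite ?orbT.
Qed.

(** The ball may live on another vertex type; its tree is pushed forward along the isomorphism,
    injective on the vertices, so that only a tree over ['I_n] remains. *)
Lemma node_good_sphere S : S0_node S ->
  exists p a b c t, good_sphere p a b c t /\ S = sphere p a b c t.
Proof.
case=> vS [[T' [B [sB [f [finj SE]]]]] nd].
have [p [a [b [c [t [U bB]]]]]] := ball_sphere sB.
have U' : uniq [:: f p, f a, f b, f c & labels (tree_map f t)].
  rewrite labels_map -[X in is_true (uniq X)]/(map f [:: p, a, b, c & labels t]).
  rewrite map_inj_in_uniq // => x y xl yl; apply: finj; by rewrite bB verts_sphere.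
have SE' : S = sphere (f p) (f a) (f b) (f c) (tree_map f t).
  by rewrite SE bB sphere_map.
exists (f p), (f a), (f b), (f c), (tree_map f t); split=> //; split=> //.
  have all z : z \in [:: f p, f a, f b, f c & labels (tree_map f t)].
    by rewrite -verts_sphere -SE' vS inE.
  rewrite addn4 -[RHS]card_ord -[LHS](card_uniqP U').
  by apply: eq_card => z; rewrite all.
by apply: sphere_good U' _; rewrite -SE'.
Qed.

Notation path_equiv := (clos_refl_trans _
  (fun X Y : {set {set 'I_n}} => S0_node X /\ S0_node Y /\ S0_adj X Y)).

Lemma S0_adj_sym X Y : S0_adj X Y -> S0_adj Y X.
Proof.
case=> T [X' [Y' [XX [YY XY]]]]; exists T, Y', X'; split=> //; split=> //.
by case: XY; [right|left].
Qed.

Lemma path_equiv_sym X Y : path_equiv X Y -> path_equiv Y X.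
Proof.
elim=> {X Y} [X Y [nX [nY XY]]|X|X Y Z _ YX _ ZY].
- by apply: rt_step; split=> //; split=> //; apply: S0_adj_sym.
- exact: rt_refl.
- exact: rt_trans ZY YX.
Qed.

Lemma eflip_path_equiv X Y : S0_node X -> S0_node Y -> eflip X Y -> path_equiv X Y.
Proof.
move=> nX nY XY; apply: rt_step; split=> //; split=> //.
exists 'I_n, X, Y; split; first exact: cx_iso_id.
by split; [exact: cx_iso_id|left].
Qed.

Lemma rotation_path_equiv p a b c t t' : rotation t t' ->
  good_sphere p a b c t ->
  good_sphere p a b c t' /\ path_equiv (sphere p a b c t) (sphere p a b c t').
Proof.
move=> r gs; have [U sz gt] := gs.
have gs' : good_sphere p a b c t'.
  split; last by rewrite -(rotation_good r).
    apply/uniq_count => z; have := proj1 (uniq_count _) U z.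
    by rewrite /= (rotation_count _ r).
  by rewrite -(rotation_size r).
split=> //; apply: eflip_path_equiv; try exact: good_sphere_node.
apply: rotation_eflip => //; first by case/andP: U.
by move=> g z; apply: outer_fresh U.
Qed.

(** Goodness is an equivalence here because the symmetric closure may traverse a rotation backwards,
    starting from either end. *)
Lemma rot_equiv_path_equiv p a b c t t' : clos_refl_sym_trans _ (@rotation _) t t' ->
  (good_sphere p a b c t <-> good_sphere p a b c t') /\
  (good_sphere p a b c t -> path_equiv (sphere p a b c t) (sphere p a b c t')).
Proof.
elim=> {t t'} [t t' r|t|t t' _ [gg pp]|t1 t2 t3 _ [g12 p12] _ [g23 p23]].
- split; last by move=> gs; have [] := rotation_path_equiv r gs.
  split=> [gs|[U sz gt]]; first by have [] := rotation_path_equiv r gs.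
  split; last by rewrite (rotation_good r).
    apply/uniq_count => z; have := proj1 (uniq_count _) U z.
    by rewrite /= (rotation_count _ r).
  by rewrite (rotation_size r).
- by split=> // _; apply: rt_refl.
- by split=> [|/gg/pp/path_equiv_sym //]; split=> /gg.
- split; first by rewrite g12.
  by move=> g1; apply: rt_trans (p12 g1) (p23 _); apply/g12.
Qed.

Lemma labels_comb1 (T : Type) (s : seq T) : labels (comb (@node1 T) s) = s.
Proof. by elim: s => //= v s ->. Qed.

Lemma good_comb1 (T : Type) (s : seq T) : good (comb (@node1 T) s).
Proof. by elim: s. Qed.

Lemma tree_map_comb1 (T1 T2 : Type) (f : T1 -> T2) s :
  tree_map f (comb (@node1 T1) s) = comb (@node1 T2) (map f s).
Proof. by elim: s => //= v s ->. Qed.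

Lemma node_to_comb S : S0_node S -> exists p a b c s,
  good_sphere p a b c (comb (@node1 _) s) /\
  path_equiv S (sphere p a b c (comb (@node1 _) s)).
Proof.
case/node_good_sphere=> p [a [b [c [t [gs ->]]]]]; have [_ _ gt] := gs.
have [[s r] _] := rot_equiv_combs (leqnn _) gt.
have [gg pp] := rot_equiv_path_equiv p a b c r.
by exists p, a, b, c, s; split; [apply/gg|apply: pp].
Qed.

Lemma comb_iso p a b c s q d e f s' :
    good_sphere p a b c (comb (@node1 _) s) ->
    good_sphere q d e f (comb (@node1 _) s') ->
  cx_iso (sphere p a b c (comb (@node1 _) s)) (sphere q d e f (comb (@node1 _) s')).
Proof.
case=> U sz _ [U' sz' _]; rewrite !labels_comb1 in U sz U' sz'.
set l := [:: p, a, b, c & s] in U; set l' := [:: q, d, e, f & s'] in U'.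
have szl : size l = size l' by rewrite /=; lia.
(* [F] matches the two vertex lists entry by entry. Its default value [q] is harmless: injectivity
   is required only on the vertices, all listed in [l]. *)
pose F x := nth q l' (index x l).
have Fl : map F l = l'.
  apply: (@eq_from_nth _ q) => [|i]; rewrite size_map // => il.
  by rewrite (nth_map p) // /F index_uniq.
exists F; split.
  move=> x y; rewrite !verts_sphere labels_comb1 -/l => xl yl.
  move/eqP; rewrite nth_uniq // -?szl ?index_mem // => /eqP.
  by move=> E; rewrite -(nth_index p xl) E nth_index.
rewrite -sphere_map tree_map_comb1.
by case: Fl => -> -> -> -> ->.
Qed.

(* Isomorphic combs with different labels are connected through a common flip [Y],
   because adjacency is up to isomorphism; hence any comb needs some flip. *)
Lemma comb_flip p a b c v s :
    good_sphere p a b c (comb (@node1 _) (v :: s)) ->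
  exists2 Y, S0_node Y & eflip (sphere p a b c (comb (@node1 _) (v :: s))) Y.
Proof.
case=> U sz _; have [U' fl] := sphere_flip U.
exists (sphere c a p v (Node b Leaf (comb (@node1 _) s) Leaf)) => //.
apply: good_sphere_node; split=> //.
  by rewrite -[RHS]sz /= cats0.
by rewrite /= good_comb1.
Qed.

Lemma comb_path_equiv p a b c s q d e f s' :
    good_sphere p a b c (comb (@node1 _) s) ->
    good_sphere q d e f (comb (@node1 _) s') ->
  path_equiv (sphere p a b c (comb (@node1 _) s)) (sphere q d e f (comb (@node1 _) s')).
Proof.
move=> gs gs'; case: s => [|v s] in gs *.
  have s0 : s' = [::].
    case: gs gs' => _ sz _ [_ sz' _]; rewrite !labels_comb1 in sz sz'.
    by apply: size0nil; rewrite /= in sz; lia.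
  (* With four vertices every pair is an edge, so no flip exists; but both spheres bound the one
     tetrahedron on all of ['I_n], hence are equal as sets. *)
  subst s'; have full p' a' b' c' : good_sphere p' a' b' c' (comb (@node1 _) [::]) ->
      p' |: [set a'; b'; c'] = [set: 'I_n].
    case=> U sz _; apply/eqP; rewrite eqEcard subsetT cardsT card_ord /=.
    apply: (@leq_trans #|[:: p'; a'; b'; c']|).
      by rewrite (card_uniqP U) -[leqLHS]sz.
    by apply/subset_leq_card/subsetP=> z; rewrite !inE !orbA.
  have [[U _ _] [U' _ _]] := (gs, gs').
  rewrite -(proj2 (sphere_ball U)) -(proj2 (sphere_ball U')) (full _ _ _ _ gs) (full _ _ _ _ gs').
  exact: rt_refl.
have [Y nY XY] := comb_flip gs.
have nX := good_sphere_node gs.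
apply: rt_trans (eflip_path_equiv nX nY XY) _; apply: rt_step; split; first exact: nY.
split; first exact: good_sphere_node.
(* The step back from [Y] undoes the same flip: the first comb represents the isomorphism class of
   the second. *)
exists 'I_n, Y, (sphere p a b c (comb (@node1 _) (v :: s))); split; first exact: cx_iso_id.
by split; [apply: comb_iso|right].
Qed.
End Nodes.

Theorem theorem4p9 (n : nat) : 4 <= n -> S0_connected n.
Proof.
move=> n4; split.
  have := enum_uniq 'I_n; have : size (enum 'I_n) = n by rewrite size_enum_ord.
  case: (enum 'I_n) => [|p [|a [|b [|c s]]]] sz U; try by exfalso; move: sz n4 => /= <-.
  exists (sphere p a b c (comb (@node1 _) s)); apply: good_sphere_node.
  by split; rewrite ?labels_comb1 ?good_comb1 //; rewrite -[RHS]sz /= addn4.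
move=> S1 S2 /node_to_comb[p [a [b [c [s [gs r1]]]]]].
move=> /node_to_comb[q [d [e [f [s' [gs' r2]]]]]].
apply: rt_trans r1 _; apply: rt_trans (comb_path_equiv gs gs') _.
exact: path_equiv_sym.
Qed.
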